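(* Let $\mathbb{K}=\mathbb{R}$ and let $N=(N_2,\dots,N_\ell)$ be a tuple of finite subsets of $\mathbb{R}$ with $N_2\supseteq N_3\supseteq\dots\supseteq N_\ell$. Let $\mathcal{I}_N$ be the cone over the $N$-Ish arrangement, i.e. the central arrangement in $\mathbb{R}^{\ell+1}$ (coordinates $x_1,\dots,x_\ell,z$) with defining polynomial $z\prod_{j=2}^{\ell}\prod_{a\in N_j}(x_1-x_j-az)\prod_{2\le i<j\le\ell}(x_i-x_j)$. For $1\le i\le \ell$ let $\mathcal{I}_i$ be the subarrangement consisting of $\{z=0\}$, the hyperplanes $\{x_1-x_j=az\}$ with $2\le j\le i$, $a\in N_j$, and the hyperplanes $\{x_j-x_k=0\}$ with $2\le j<k\le i$; this gives a filtration $\mathcal{I}_N=\mathcal{I}_\ell\supseteq\dots\supseteq\mathcal{I}_1$ satisfying the supersolvability conditions (rank $\mathcal{I}_i=i$, and for distinct $H,H'\in\mathcal{I}_i$ some $H''\in\mathcal{I}_{i-1}$ contains $H\cap H'$), with induced maps $\pi_i:\mathrm{Ch}(\mathcal{I}_i)\to\mathrm{Ch}(\mathcal{I}_{i-1})$ sending a chamber to the unique chamber containing it. A chamber $B\in\mathrm{Ch}(\mathcal{I}_i)$ is called canonical if $i\le 2$, or if $i\ge 3$, $\pi_i(B)$ is canonical and the fiber $\pi_i^{-1}(\pi_i(B))$ is linearly ordered in the poset $P(\mathcal{I}_i,B)$ (chambers ordered by inclusion of the sets of hyperplanes separating them from $B$). Then the chamber $$B_\ell:=\Big(\bigcap_{2\le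 j\le\ell}\{x_1-x_j<\min N_j\}\Big)\cap\{x_2<x_3<\dots<x_\ell\}\cap\{z>0\}\in\mathrm{Ch}(\mathcal{I}_N)$$ is canonical.
   Context: Here $\mathbb{K}=\mathbb{R}$ and $\min N_j$ refers to the minimal element of $N_j$; implicitly the $N_j$ are nonempty for this expression to make sense.
   Formalization: In the definition of B_ℓ the inequalities x_1 − x_j < min N_j are replaced by the homogeneous x_1 − x_j < (min N_j) z, since the printed set is in general not a chamber of the cone. *)

(* Defs.v *)
From mathcomp Require Import all_boot all_order all_algebra.
From mathcomp Require Import all_classical all_reals all_analysis.

Set Implicit Arguments.
Unset Strict Implicit.
Unset Printing Implicit Defensive.

Import Order.TTheory GRing.Theory Num.Theory.
Import numFieldNormedType.Exports.

Local Open Scope classical_set_scope.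
Local Open Scope ring_scope.

Section Arrangements.
Context {R : realType} {V : normedModType R}.

(* An arrangement is a set of hyperplanes and a hyperplane is a set of points,
   so proportional linear forms give the same hyperplane. *)
Implicit Types (A : set (set V)) (B C D H : set V).

Definition arr_compl A : set V := ~` \bigcup_(H in A) H.

Definition Ch A : set (set V) :=
  [set connected_component (arr_compl A) v | v in arr_compl A].

Definition separates H C D : Prop :=
  exists alpha : {scalar V},
    [/\ H = [set v | alpha v = 0],
        (forall v, C v -> 0 < alpha v) &
        (forall v, D v -> alpha v < 0)].

Definition sep A C D : set (set V) := [set H | A H /\ separates H C D].

(* The order of the poset of regions P(A, B). *)
Definition region_le A B C D : Prop := sep A B C `<=` sep A B D.

Definition linearly_ordered A B (F : set (set V)) : Prop :=
  forall C D, F C -> F D -> region_le A B C D \/ region_le A B D C.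

(* The unique chamber of A containing C, for C a chamber of an arrangement
   that contains A; an arbitrary set if there is no such chamber. *)
Definition Ch_proj A C : set V := xget set0 [set D | Ch A D /\ C `<=` D].

Section Filtration.
Variable I : nat -> set (set V).

Definition pi_map (i : nat) : set V -> set V := Ch_proj (I i.-1).

Definition fiber (i : nat) C : set (set V) :=
  [set D | Ch (I i) D /\ pi_map i D = C].

Inductive canonical_chamber : nat -> set V -> Prop :=
| canonical_base i B : (i <= 2)%N -> Ch (I i) B -> canonical_chamber i B
| canonical_step i B : (3 <= i)%N -> Ch (I i) B ->
    canonical_chamber i.-1 (pi_map i B) ->
    linearly_ordered (I i) B (fiber i (pi_map i B)) ->
    canonical_chamber i B.

End Filtration.
End Arrangements.

Section NIsh.
Context {R : realType}.

(* The coordinates of 'rV[R]_l.+1 are (x_1, ..., x_l, z); xcoord j is meant for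
   1 <= j <= l. *)
Definition xcoord {l : nat} (j : nat) (v : 'rV[R]_l.+1) : R :=
  v ord0 (inord j.-1).
Definition zcoord {l : nat} (v : 'rV[R]_l.+1) : R := v ord0 ord_max.

(* The subarrangement I_i of the cone over the N-Ish arrangement in R^(l+1);
   the whole cone is the case i = l. Only N 2, ..., N i are used. *)
Definition Ish (l : nat) (N : nat -> set R) (i : nat) :
    set (set 'rV[R]_l.+1) :=
  [set [set v | zcoord v = 0]]
  `|` [set H | exists j a, [/\ (2 <= j <= i)%N, N j a &
                 H = [set v | xcoord 1 v - xcoord j v = a * zcoord v]]]
  `|` [set H | exists j k, [/\ (2 <= j)%N, (j < k <= i)%N &
                 H = [set v | xcoord j v - xcoord k v = 0]]].

(* The minimal element of S; the default 0 is only used if there is none. *)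
Definition min_elt (S : set R) : R := xget 0 (S `&` lbound S).

(* The chamber B_l. The affine inequalities x_1 - x_j < min N_j of the slice
   z = 1 are homogenized, as a chamber of the cone requires. *)
Definition B_Ish (l : nat) (N : nat -> set R) : set 'rV[R]_l.+1 :=
  [set v | [/\ forall j, (2 <= j <= l)%N ->
                 xcoord 1 v - xcoord j v < min_elt (N j) * zcoord v,
               forall j, (2 <= j < l)%N -> xcoord j v < xcoord j.+1 v &
               0 < zcoord v]].

End NIsh.

Arguments Ish {R} l N i.
Arguments B_Ish {R} l N.

(* Main.v *)
(** On the chamber [B_(i-1)] of [I_(i-1)], where [z > 0], the hyperplanes of
    [I_i] that are not in [I_(i-1)] are the graphs [x_i = x_1 - a z]
    ([a] in [N_i]) and [x_i = x_j] ([2 <= j < i]).  Since [N_i] is contained in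
    every [N_j], the point [x_1 - a z] lies to the left of all the [x_j], so
    these graphs are pairwise disjoint over [B_(i-1)] and totally ordered.  The
    fiber over [B_(i-1)] records the position of [x_i] among them, and in [B_i]
    the coordinate [x_i] is to the right of all of them. *)

Require Import Defs.
From HB Require Import structures.
From mathcomp Require Import all_boot all_order all_algebra.
From mathcomp Require Import all_classical all_reals all_analysis.
From mathcomp Require Import zify ring lra.

Import Order.TTheory GRing.Theory Num.Theory.
Import numFieldNormedType.Exports.

Local Open Scope classical_set_scope.
Local Open Scope ring_scope.

(** * Chambers, projections and separation in an arbitrary arrangement *)

Section Chambers.
Context {R : realType} {V : normedModType R}.
Implicit Types (A : set (set V)) (B C D H : set V).

Definition segment_closed B : Prop :=
  forall p q (t : R), B p -> B q -> 0 <= t <= 1 -> B (p + t *: (q - p)).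

(** A nonempty convex set is the union of the segments from one of its points [p], all connected and
    sharing [p]. *)
Lemma segment_closed_connected B : segment_closed B -> connected B.
Proof.
move=> cB; have [->|/set0P[p Bp]] := eqVneq B set0; first exact: connected0.
pose S q : set V := [set p + t *: (q - p) | t in `[0, 1]%classic].
have -> : B = \bigcup_(q in B) S q.
  apply/seteqP; split=> [q Bq|_ [q Bq [t /= t01 <-]]].
    exists q => //; exists 1 => /=; first by rewrite in_itv /= ler01 lexx.
    by rewrite scale1r addrC subrK.
  by apply: cB; rewrite // -in_itv.
apply: bigcup_connected => [|q Bq].
  exists p => q Bq; exists 0 => /=; first by rewrite in_itv /= lexx ler01.
  by rewrite scale0r addr0.
apply: connected_continuous_connected; first exact: segment_connected.
apply: continuous_subspaceT => t.
apply: cvgD; first exact: cvg_cst.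
by apply: cvgZr_tmp; exact: cvg_id.
Qed.

(** The image of [B] under [f] is an interval that avoids 0. *)
Lemma connected_pos B (f : V -> R) p : connected B -> continuous f ->
  (forall v, B v -> f v != 0) -> B p -> 0 < f p -> forall v, B v -> 0 < f v.
Proof.
move=> cB cf f0 Bp fp v Bv; rewrite ltNge; apply/negP => fv.
have /connected_intervalP itv : connected (f @` B).
  by apply: connected_continuous_connected => //; exact: continuous_subspaceT.
have [w Bw fw] : (f @` B) 0.
  by apply: (itv (f v) (f p)); [exists v|exists p|rewrite fv ltW].
by have := f0 w Bw; rewrite fw eqxx.
Qed.

(** Convexity puts [B] inside the component of [p], and the maximality hypothesis, applied to that
    component, gives the converse. *)
Lemma ChP A B p : segment_closed B -> B p -> B `<=` arr_compl A ->
  (forall C, connected C -> C p -> C `<=` arr_compl A -> C `<=` B) -> Ch A B.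
Proof.
move=> cB Bp BA maxB; exists p; first exact: BA.
apply/seteqP; split; last first.
  by apply: connected_component_max => //; exact: segment_closed_connected.
apply: maxB; first exact: component_connected.
  by apply: connected_component_refl; exact: BA.
exact: connected_component_sub.
Qed.

Lemma Ch_eq A C D p : Ch A C -> Ch A D -> C p -> D p -> C = D.
Proof.
move=> [u _ <-] [v _ <-] Cp Dp.
by rewrite (same_connected_component Cp) (same_connected_component Dp).
Qed.

Lemma Ch_sub A C : Ch A C -> C `<=` arr_compl A.
Proof. by move=> [v _ <-]; exact: connected_component_sub. Qed.

Lemma Ch_nonempty A C : Ch A C -> C !=set0.
Proof. by move=> [v Av <-]; exists v; exact: connected_component_refl. Qed.

Lemma Ch_projE A C D p : Ch A D -> C p -> C `<=` D -> Ch_proj A C = D.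
Proof.
move=> hD Cp CD; apply: xget_unique => // E [hE CE].
exact: (Ch_eq A E D p hE hD (CE p Cp) (CD p Cp)).
Qed.

(** A nonempty value of [Ch_proj] is not the default [set0], so it comes from a chamber that
    contains [C]. *)
Lemma Ch_proj_sub A C D : D !=set0 -> Ch_proj A C = D -> C `<=` D.
Proof.
move=> [p Dp]; rewrite /Ch_proj; case: xgetP => [E _ [_ CE] <- //|_ D0].
by move: Dp; rewrite -D0.
Qed.

Lemma segment_zero (f : {scalar V}) p q : 0 < f p -> f q < 0 ->
  exists2 t : R, 0 <= t <= 1 & f (p + t *: (q - p)) = 0.
Proof.
move=> fp fq; have d : 0 < f p - f q by lra.
exists (f p / (f p - f q)).
  by rewrite ler_pdivrMr // divr_ge0 ?ltW //=; lra.
by rewrite linearD linearZ linearB /=; field; rewrite gt_eqF.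
Qed.

(** A segment from [B] to [C] stays in [D], but would cross a separating hyperplane. *)
Lemma not_separates_in_convex H B C D : segment_closed D -> B !=set0 ->
  C !=set0 -> B `<=` D -> C `<=` D -> D `<=` ~` H -> ~ separates H B C.
Proof.
move=> cD [p Bp] [q Cq] BD CD DH [f [HE fB fC]].
have [t t01 ft] := segment_zero f p q (fB _ Bp) (fC _ Cq).
by apply: (DH (p + t *: (q - p))); [apply: cD; auto|rewrite HE].
Qed.

(** The form [g] given by [separates] is only known to have the same zeros as [f]. On the segment
    from [p] to [v] its zero is also a zero of [f], and is not [v] since [g v < 0]. As [f] is affine
    there and [f p > 0], it is negative at [v]. *)
Lemma separates_neg (f : {scalar V}) B C : B !=set0 ->
  (forall v, B v -> 0 < f v) -> separates [set v | f v = 0] B C ->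
  forall v, C v -> f v < 0.
Proof.
move=> [p Bp] fB [g [HE gB gC]] v Cv.
have [t /andP[t0 t1] gt] := segment_zero g p v (gB _ Bp) (gC _ Cv).
have : [set v | f v = 0] (p + t *: (v - p)) by rewrite HE.
rewrite /= linearD linearZ linearB /= => ft.
have fp := fB _ Bp; rewrite ltNge; apply/negP => fv.
have ft' : (1 - t) * f p + t * f v = 0 by rewrite -ft; ring.
have [t1'|t1'] := ltrP t 1.
  have tp : 0 < (1 - t) * f p by rewrite mulr_gt0 // subr_gt0.
  have tv : 0 <= t * f v by rewrite mulr_ge0.
  by move: (ltr_wpDr tv tp); rewrite ft' ltxx.
have tE : t = 1 by apply/eqP; rewrite eq_le t1.
have := gC _ Cv; move: gt; rewrite tE scale1r addrC subrK => ->.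
by rewrite ltxx.
Qed.

End Chambers.

(** * Linear forms of the Ish arrangements and the convex cones B_i *)

Section IshChambers.
Context {R : realType} {l : nat}.
Implicit Types (v : 'rV[R]_l.+1) (N : nat -> set R).

(* The linear form of the hyperplane [x_j - x_k = a z], with its sign
   chosen so that it is positive on [B_Ish]. *)
Definition ish_form (k j : nat) (a : R) v : R :=
  xcoord k v - xcoord j v + a * zcoord v.

Lemma ish_form_is_linear k j a : scalar (ish_form k j a).
Proof. by move=> t u v; rewrite /ish_form /xcoord /zcoord !mxE; ring. Qed.

HB.instance Definition _ k j a :=
  @GRing.isLinear.Build R 'rV[R]_l.+1 R _ (ish_form k j a)
    (ish_form_is_linear k j a).

Lemma zcoord_continuous : continuous (zcoord : 'rV[R]_l.+1 -> R).
Proof. exact: coord_continuous. Qed.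

Lemma ish_form_continuous k j a : continuous (ish_form k j a).
Proof.
move=> v.
have xc (m : 'I_l.+1) : {for v, continuous (fun w : 'rV[R]_l.+1 => w ord0 m)}.
  exact: coord_continuous.
have ac : {for v, continuous (fun=> a : R)} by exact: cst_continuous.
exact: (continuousD (continuousB (xc (inord k.-1)) (xc (inord j.-1)))
  (continuousM ac (xc ord_max))).
Qed.

(* The cylinder over the chamber [B_i]; [B_Ish l N] is the case [i = l]. *)
Definition Ish_base (N : nat -> set R) (i : nat) : set 'rV[R]_l.+1 :=
  [set v | [/\ forall j, (2 <= j <= i)%N ->
                 xcoord 1 v - xcoord j v < min_elt (N j) * zcoord v,
               forall j, (2 <= j < i)%N -> xcoord j v < xcoord j.+1 v &
               0 < zcoord v]].

Lemma Ish_baseP N i v : Ish_base N i v <->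
  [/\ forall j, (2 <= j <= i)%N -> 0 < ish_form j 1 (min_elt (N j)) v,
      forall j, (2 <= j < i)%N -> 0 < ish_form j.+1 j 0 v & 0 < zcoord v].
Proof.
by rewrite /ish_form; split=> -[h1 h2 h3]; split=> // j hj;
  first [have := h1 j hj | have := h2 j hj]; lra.
Qed.

Lemma Ish_base_segment_closed N i : segment_closed (Ish_base N i).
Proof.
have pos (f g t : R) : 0 < f -> 0 < g -> 0 <= t <= 1 -> 0 < f + t * (g - f).
  by move=> f0 g0 /andP[t0 t1]; nra.
move=> p q t /Ish_baseP[p1 p2 p3] /Ish_baseP[q1 q2 q3] t01; apply/Ish_baseP.
split=> [j hj|j hj|].
- by rewrite linearD linearZ linearB /=; apply: pos; auto.
- by rewrite linearD linearZ linearB /=; apply: pos; auto.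
- by rewrite /zcoord !mxE; apply: pos.
Qed.

Lemma Ish_base_sub N i : Ish_base N i `<=` Ish_base N i.-1.
Proof. by move=> v [h1 h2 h3]; split=> // j hj; [apply: h1|apply: h2]; lia. Qed.

Lemma Ish_base_lt N i v j k : Ish_base N i v -> (2 <= j)%N -> (j < k <= i)%N ->
  xcoord j v < xcoord k v.
Proof.
move=> [_ h2 _] hj; elim: k => [|k IHk] hk; first by lia.
have [jk|jk] := ltnP j k; last by have -> : j = k by [lia|]; apply: h2; lia.
by apply: (lt_trans (IHk _)); [lia|apply: h2; lia].
Qed.

Lemma Ish_line_mem N i j a : (2 <= j <= i)%N -> N j a ->
  Ish l N i [set v | ish_form j 1 a v = 0].
Proof.
move=> hj Na; left; right; exists j, a; split=> //.
by apply/seteqP; split=> v /=; rewrite /ish_form; lra.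
Qed.

Lemma Ish_diag_mem N i j k : (2 <= j)%N -> (j < k <= i)%N ->
  Ish l N i [set v | ish_form k j 0 v = 0].
Proof.
move=> hj hk; right; exists j, k; split=> //.
by apply/seteqP; split=> v /=; rewrite /ish_form; lra.
Qed.

(* A hyperplane of [I_i] that is not in [I_(i-1)] is the zero set of
   [ish_form i j a] with [(j, a)] as follows. *)
Definition new_form N (i j : nat) (a : R) : Prop :=
  (j = 1%N /\ N i a) \/ ((2 <= j < i)%N /\ a = 0).

Lemma Ish_new N i H : Ish l N i H -> Ish l N i.-1 H \/
  exists j a, new_form N i j a /\ H = [set v | ish_form i j a v = 0].
Proof.
move=> [[Hz|[j [a [hj Na ->]]]]|[j [k [hj hk ->]]]]; first by left; left; left.
- have [ji|ji] := ltnP j i.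
    by left; left; right; exists j, a; split=> //; lia.
  have E : j = i by lia.
  rewrite {}E in hj Na *; right; exists 1%N, a; split; first by left.
  by apply/seteqP; split=> v /=; rewrite /ish_form; lra.
- have [ki|ki] := ltnP k i; first by left; right; exists j, k; split=> //; lia.
  have E : k = i by lia.
  rewrite {}E in hk *; right; exists j, 0; split; first by right; split=> //; lia.
  by apply/seteqP; split=> v /=; rewrite /ish_form; lra.
Qed.

End IshChambers.

(** Induction on a list enumerating [S] produces a minimum, so [min_elt] does not take its default
    value 0. *)
Lemma min_eltP {R : realType} (S : set R) : finite_set S -> S !=set0 ->
  S (min_elt S) /\ lbound S (min_elt S).
Proof.
move=> /finite_seqP[s ->] [x xs]; rewrite /min_elt.
suff [m hm] : exists m, ([set` s] `&` lbound [set` s]) m by exact: (xgetI 0 hm).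
elim: s x xs => [//|y s IHs] _ _; case: s IHs => [_|z s IHs].
  by exists y; split=> [|t] /=; rewrite inE // => /eqP ->.
have [m [ms mlb]] := IHs z (mem_head z s).
exists (Num.min y m); split=> /=.
  by rewrite inE; case: leP => _; rewrite ?eqxx //; apply/orP; right.
move=> t /=; rewrite inE => /orP[/eqP->|ts]; first by rewrite ge_min lexx.
by rewrite ge_min mlb ?orbT.
Qed.

(** * B_i is a chamber of I_i, and it projects to B_(i-1) *)

Section Canonical.
Context {R : realType} {l : nat} {N : nat -> set R}.
Context (hfin : forall j, (2 <= j <= l)%N -> finite_set (N j)).
Context (hne : forall j, (2 <= j <= l)%N -> N j !=set0).
Context (hN : forall j, (2 <= j < l)%N -> N j.+1 `<=` N j).
Implicit Types v : 'rV[R]_l.+1.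

Let min_mem j : (2 <= j <= l)%N -> N j (min_elt (N j)).
Proof. by move=> hj; case: (min_eltP (N j) (hfin _ hj) (hne _ hj)). Qed.

Let min_le j a : (2 <= j <= l)%N -> N j a -> min_elt (N j) <= a.
Proof.
by move=> hj Na; case: (min_eltP (N j) (hfin _ hj) (hne _ hj)) => _ /(_ _ Na).
Qed.

Lemma N_sub j k : (2 <= j)%N -> (j <= k <= l)%N -> N k `<=` N j.
Proof.
move=> hj; elim: k => [|k IHk] hk; first by lia.
have [jk|jk] := leqP j k; last by have -> : j = k.+1 by lia.
by apply: (subset_trans (hN k _) (IHk _)); lia.
Qed.

Lemma Ish_base_line_gt0 i j a v : (2 <= j <= i)%N -> (i <= l)%N ->
  Ish_base N i v -> N j a -> 0 < ish_form j 1 a v.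
Proof.
move=> hj il [h1 _ z0] Na; have := h1 j hj.
have /(min_le j a) : (2 <= j <= l)%N by lia.
by move=> /(_ Na); rewrite /ish_form; nra.
Qed.

Lemma Ish_base_compl i : (i <= l)%N ->
  Ish_base N i `<=` arr_compl (Ish l N i).
Proof.
move=> il v Bv [H [[->|[j [a [hj Na ->]]]]|[j [k [hj hk ->]]]]] /= Hv.
- by case: Bv => _ _; rewrite Hv ltxx.
- by have := Ish_base_line_gt0 i j a v hj il Bv Na; rewrite /ish_form; lra.
- by have := Ish_base_lt N i v j k Bv hj hk; lra.
Qed.

Lemma Ish_base_nonempty i : (i <= l)%N -> @Ish_base R l N i !=set0.
Proof.
move=> il.
(* The witness has z = 1, x_j = j for j >= 2 and x_1 = min N_2; then x_1 - x_j < min N_2 <= min N_j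
   because N_j is contained in N_2. The test for [ord_max] comes first, so that z = 1 also when l =
   0. *)
pose p : 'rV[R]_l.+1 := \row_(k < l.+1)
  if k == ord_max then 1
  else if k == ord0 then min_elt (N 2) else (val k)%:R + 1.
have pz : zcoord p = 1 by rewrite /zcoord mxE eqxx.
have px j : (2 <= j <= l)%N -> xcoord j p = j%:R.
  move=> hj; have kj : val (inord j.-1 : 'I_l.+1) = j.-1 by rewrite /= inordK; lia.
  rewrite /xcoord mxE -!val_eqE kj /= !ifN ?natr1; try lia.
  by congr (_%:R); lia.
have p1 : (2 <= l)%N -> xcoord 1 p = min_elt (N 2).
  move=> hl; rewrite /xcoord mxE -!val_eqE /= inordK //.
  by rewrite ifN //; lia.
exists p; split=> [j hj|j hj|]; last by rewrite pz ltr01.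
  rewrite pz mulr1 p1 ?px; try lia.
  have : min_elt (N 2) <= min_elt (N j).
    by apply: min_le; [lia|apply: (N_sub 2 j); [lia|lia|apply: min_mem; lia]].
  have : 0 < j%:R :> R by rewrite ltr0n; lia.
  by lra.
by rewrite !px ?ltr_nat; lia.
Qed.

(** Each inequality defining [Ish_base N i] fixes the sign of a form whose kernel belongs to I_i,
    since min N_j lies in N_j. A connected set that avoids these kernels and contains [p] keeps all
    the signs of [p]. *)
Lemma Ish_base_Ch i : (i <= l)%N -> Ch (Ish l N i) (Ish_base N i).
Proof.
move=> il; have [p Bp] := Ish_base_nonempty i il.
apply: (ChP _ _ p (Ish_base_segment_closed N i) Bp (Ish_base_compl i il)).
move=> C cC Cp CA v Cv.
have nz (f : 'rV[R]_l.+1 -> R) : Ish l N i [set w | f w = 0] ->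
    forall w, C w -> f w != 0.
  by move=> Hf w Cw; apply/eqP => fw; apply: (CA w Cw); exists [set w | f w = 0].
have [p1 p2 p3] := (Ish_baseP N i p).1 Bp.
apply/Ish_baseP; split=> [j hj|j hj|].
- apply: (connected_pos C _ p cC (ish_form_continuous _ _ _) _ Cp) => //.
    by apply: nz; apply: Ish_line_mem => //; apply: min_mem; lia.
  exact: p1.
- apply: (connected_pos C _ p cC (ish_form_continuous _ _ _) _ Cp) => //.
    by apply: nz; apply: Ish_diag_mem; lia.
  exact: p2.
- apply: (connected_pos C _ p cC zcoord_continuous _ Cp) => //.
  by apply: nz; left; left.
Qed.

Lemma Ish_proj_base i : (i <= l)%N ->
  pi_map (Ish l N) i (Ish_base N i) = Ish_base N i.-1.
Proof.
move=> il; have [p Bp] := Ish_base_nonempty i il.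
apply: (Ch_projE _ _ _ p _ Bp); last exact: Ish_base_sub.
by apply: Ish_base_Ch; lia.
Qed.

(** * Linear order on the fiber, and canonicity *)

Lemma new_form_gt0 i j a v : (3 <= i <= l)%N -> new_form N i j a ->
  Ish_base N i v -> 0 < ish_form i j a v.
Proof.
move=> hi [[-> Na]|[hj ->]] Bv.
  by apply: (Ish_base_line_gt0 i _ _ _ _ _ Bv) => //; lia.
have ji : xcoord j v < xcoord i v by apply: (Ish_base_lt N i) => //; lia.
by rewrite /ish_form; lra.
Qed.

(** All new forms have coefficient 1 at x_i, so the difference of two of them involves only the
    other coordinates, and it keeps a constant weak sign on B_(i-1). *)
Lemma new_form_total i j a k b : (3 <= i <= l)%N ->
  new_form N i j a -> new_form N i k b ->
  (forall v, Ish_base N i.-1 v -> ish_form i j a v <= ish_form i k b v) \/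
  (forall v, Ish_base N i.-1 v -> ish_form i k b v <= ish_form i j a v).
Proof.
(* The difference of the two forms is [ish_form m 1 c], positive on B_(i-1) because [c] also lies in
   [N m]. *)
have line_diag c m v : (3 <= i <= l)%N -> N i c -> (2 <= m < i)%N ->
    Ish_base N i.-1 v -> ish_form i m 0 v <= ish_form i 1 c v.
  move=> hi Nc hm Bv.
  have : 0 < ish_form m 1 c v.
    apply: (Ish_base_line_gt0 i.-1 _ _ _ _ _ Bv); try lia.
    by apply: (N_sub m i) => //; lia.
  by rewrite /ish_form; lra.
move=> hi [[-> Na]|[hj ->]] [[-> Nb]|[hk ->]].
- have [ab|ba] := leP a b; [left|right] => v [_ _ z0];
    by rewrite /ish_form; nra.
- by right => v Bv; apply: line_diag.
- by left => v Bv; apply: line_diag.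
- have [jk|kj|->] := ltngtP j k; last by left.
    right => v Bv; have : xcoord j v < xcoord k v.
      by apply: (Ish_base_lt N i.-1) => //; lia.
    by rewrite /ish_form; lra.
  left => v Bv; have : xcoord k v < xcoord j v.
    by apply: (Ish_base_lt N i.-1) => //; lia.
  by rewrite /ish_form; lra.
Qed.

(** Both B_i and [C] lie in the convex set B_(i-1), which no hyperplane of I_(i-1) meets; hence only
    new hyperplanes can separate them. *)
Lemma Ish_sep_new i C H : (3 <= i <= l)%N -> C !=set0 ->
  C `<=` Ish_base N i.-1 -> sep (Ish l N i) (Ish_base N i) C H ->
  exists j a, [/\ new_form N i j a, H = [set v | ish_form i j a v = 0] &
    forall v, C v -> ish_form i j a v < 0].
Proof.
move=> hi C0 CB [HA HBC].
have il : (i <= l)%N by lia.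
case: (Ish_new N i H HA) => [Hold|[j [a [ja HE]]]].
  case: (not_separates_in_convex H (Ish_base N i) C (Ish_base N i.-1)) => //.
  - exact: Ish_base_segment_closed.
  - exact: Ish_base_nonempty.
  - exact: Ish_base_sub.
  - move=> v Bv Hv; have il' : (i.-1 <= l)%N by lia.
    by apply: (Ish_base_compl i.-1 il' v Bv); exists H.
exists j, a; split=> //.
apply: (separates_neg (ish_form i j a) (Ish_base N i) C).
- exact: Ish_base_nonempty.
- by move=> v; exact: new_form_gt0.
- by rewrite -HE.
Qed.

Lemma Ish_fiber_linear i : (3 <= i <= l)%N ->
  linearly_ordered (Ish l N i) (Ish_base N i)
    (fiber (Ish l N) i (Ish_base N i.-1)).
Proof.
move=> hi C D [hC pC] [hD pD].
have B0 : @Ish_base R l N i.-1 !=set0 by apply: Ish_base_nonempty; lia.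
have CB := Ch_proj_sub _ _ _ B0 pC; have DB := Ch_proj_sub _ _ _ B0 pD.
have C0 := Ch_nonempty _ _ hC; have D0 := Ch_nonempty _ _ hD.
(* If [C] and [D] were incomparable, some [H] would separate B_i from [C] only and some [K] from [D]
   only. The smaller of their two forms on B_(i-1) is negative wherever the larger one is, so its
   kernel separates B_i from both. *)
apply: contrapT => /not_orP[/existsNP[H /not_implyP[HC HD]]].
move=> /existsNP[K /not_implyP[KD KC]].
have [j [a [ja HE Cneg]]] := Ish_sep_new i C H hi C0 CB HC.
have [k [b [kb KE Dneg]]] := Ish_sep_new i D K hi D0 DB KD.
case: (new_form_total i j a k b hi ja kb) => le_form.
- apply: HD; split; first exact: (proj1 HC).
  exists (ish_form i j a); split=> // v.
    exact: new_form_gt0.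
  by move=> Dv; apply: (le_lt_trans (le_form v (DB v Dv))); exact: Dneg.
- apply: KC; split; first exact: (proj1 KD).
  exists (ish_form i k b); split=> // v.
    exact: new_form_gt0.
  by move=> Cv; apply: (le_lt_trans (le_form v (CB v Cv))); exact: Cneg.
Qed.

Lemma Ish_base_canonical i : (i <= l)%N ->
  canonical_chamber (Ish l N) i (Ish_base N i).
Proof.
elim: i => [|i IHi] il.
  by apply: canonical_base => //; exact: Ish_base_Ch.
have [i2|i3] := leqP i.+1 2.
  by apply: canonical_base => //; exact: Ish_base_Ch.
apply: canonical_step => //; first exact: Ish_base_Ch.
  by rewrite Ish_proj_base //; apply: IHi; exact: ltnW.
by rewrite Ish_proj_base //; apply: Ish_fiber_linear; rewrite i3.
Qed.

End Canonical.

Theorem theorem3p3 (R : realType) (l : nat) (N : nat -> set R)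
  (hl : (1 <= l)%N)
  (hfin : forall j, (2 <= j <= l)%N -> finite_set (N j))
  (hne : forall j, (2 <= j <= l)%N -> N j !=set0)
  (hN : forall j, (2 <= j < l)%N -> N j.+1 `<=` N j) :
  canonical_chamber (Ish l N) l (B_Ish l N).
Proof. exact: (Ish_base_canonical hfin hne hN l (leqnn l)). Qed.
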